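(* Let $X$ be a topological space, let $P$ be a pre-meadow with $\mathbf{a}$ such that the lattice $0\cdot P$ is isomorphic to $\mathrm{Open}(X)$, and let $\Phi:0\cdot P\to\mathrm{Open}(X)$ be an isomorphism of lattices. Then there exists a presheaf of rings $\mathcal{F}_{P,\Phi}$ on $X$ defined by $\mathcal{F}_{P,\Phi}(U)=P_{\Phi^{-1}(U)}$ for every open set $U\subseteq X$.
   Context: $\mathrm{Open}(X)$ is the lattice of open subsets of $X$ ordered by inclusion. A presheaf $\mathcal{F}$ of commutative rings on $X$ is required to satisfy $\mathcal{F}(\emptyset)=0$, the zero ring. A pre-meadow is a set $P$ with two distinct elements $0,1$, binary operations $+,\cdot$ and a unary operation $-$ satisfying: $(P_1)$ $(x+y)+z=x+(y+z)$; $(P_2)$ $x+y=y+x$; $(P_3)$ $x+0=x$; $(P_4)$ $x+(-x)=0\cdot x$; $(P_5)$ $(x\cdot y)\cdot z=x\cdot(y\cdot z)$; $(P_6)$ $x\cdot y=y\cdot x$; $(P_7)$ $1\cdot x=x$; $(P_8)$ $x\cdot(y+z)=x\cdot y+x\cdot z$; $(P_9)$ $-(-x)=x$; $(P_{10})$ $0\cdot(x+y)=0\cdot x\cdot y$. The set $0\cdot P=\{0\cdot x\mid x\in P\}$ is partially ordered by $z\le z'$ iff $z\cdot z'=z$. For $z\in 0\cdot P$ put $P_z=\{x\in P\mid 0\cdot x=z\}$; with the operations of $P$ it is a commutative ring with zero $z$ and unit $1+z$. A pre-meadow with $\mathbf{a}$ is a pre-meadow $P$ for which there exists a unique element of $0\cdot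 P$, denoted $\mathbf{a}$, such that $|P_{\mathbf{a}}|=1$ and $x+\mathbf{a}=\mathbf{a}$ for all $x\in P$. The restriction maps of $\mathcal{F}_{P,\Phi}$ are the transition maps of $P$: for open sets $V\subseteq U$, $\rho_{V,U}:P_{\Phi^{-1}(U)}\to P_{\Phi^{-1}(V)}$ is $x\mapsto x+\Phi^{-1}(V)$. *)

(* Defs.v *)
From HB Require Import structures.
From mathcomp Require Import all_boot all_order all_algebra.
From mathcomp Require Import boolp classical_sets topology.

Set Implicit Arguments.
Unset Strict Implicit.
Unset Printing Implicit Defensive.

Import Order.TTheory GRing.Theory.

Local Open Scope classical_set_scope.

Declare Scope pre_meadow_scope.
Delimit Scope pre_meadow_scope with PM.

HB.mixin Record isPreMeadow P of Choice P := {
  pm0 : P;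
  pm1 : P;
  pm_add : P -> P -> P;
  pm_mul : P -> P -> P;
  pm_opp : P -> P;
  pm01 : pm0 <> pm1;
  pm_addA : forall x y z, pm_add (pm_add x y) z = pm_add x (pm_add y z);
  pm_addC : forall x y, pm_add x y = pm_add y x;
  pm_addx0 : forall x, pm_add x pm0 = x;
  pm_addxN : forall x, pm_add x (pm_opp x) = pm_mul pm0 x;
  pm_mulA : forall x y z, pm_mul (pm_mul x y) z = pm_mul x (pm_mul y z);
  pm_mulC : forall x y, pm_mul x y = pm_mul y x;
  pm_mul1x : forall x, pm_mul pm1 x = x;
  pm_mulDr : forall x y z,
    pm_mul x (pm_add y z) = pm_add (pm_mul x y) (pm_mul x z);
  pm_oppK : forall x, pm_opp (pm_opp x) = x;
  pm_mul0D : forall x y, pm_mul pm0 (pm_add x y) = pm_mul (pm_mul pm0 x) y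
}.

#[short(type="preMeadowType")]
HB.structure Definition PreMeadow := {P of Choice P & isPreMeadow P}.

Notation "0" := pm0 : pre_meadow_scope.
Notation "1" := pm1 : pre_meadow_scope.
Notation "x + y" := (pm_add x y) : pre_meadow_scope.
Notation "x * y" := (pm_mul x y) : pre_meadow_scope.
Notation "- x" := (pm_opp x) : pre_meadow_scope.

Section PreMeadowTheory.
Variable P : preMeadowType.
Implicit Types x y z : P.
Local Open Scope pre_meadow_scope.

Lemma pm_mul00 : 0 * 0 = 0 :> P.
Proof.
have := pm_mul0D (1 : P) 0.
by rewrite pm_addx0 [0 * 1]pm_mulC pm_mul1x => <-.
Qed.

Lemma pm_mul0K x : 0 * (0 * x) = 0 * x.
Proof. by rewrite -pm_mulA pm_mul00. Qed.

Lemma pm_mul0_idem x : 0 * x + 0 * x = 0 * x.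
Proof.
by rewrite [0 * x]pm_mulC -pm_mulDr pm_addx0.
Qed.

Lemma pm_addx0x x : x + 0 * x = x.
Proof.
by rewrite -{1}(pm_mul1x x) ![_ * x]pm_mulC -pm_mulDr pm_addx0 pm_mulC pm_mul1x.
Qed.

Lemma pm_mul0DE x y : 0 * (x + y) = (0 * x) * (0 * y).
Proof.
by rewrite -pm_mul0K pm_mul0D -pm_mulA [0 * (0 * x)]pm_mulC pm_mulA.
Qed.

Lemma pm_mul0M x y : 0 * (x * y) = 0 * (x + y).
Proof. by rewrite pm_mul0D pm_mulA. Qed.

Lemma pm_mul0xx x : (0 * x) * x = 0 * x.
Proof. by rewrite -pm_mul0D pm_mulDr pm_mul0_idem. Qed.

Lemma pm_mul0x0x x : (0 * x) * (0 * x) = 0 * x.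
Proof. by rewrite -pm_mul0DE pm_mulDr pm_mul0_idem. Qed.

Lemma pm_mul0N x : 0 * (- x) = 0 * x.
Proof. by rewrite -pm_addxN pm_oppK pm_addC pm_addxN. Qed.

End PreMeadowTheory.

(* The set of elements 0 * x, ordered below by z <= z' iff z * z' = z. *)
Record zeros (P : preMeadowType) := Zeros {
  zval :> P;
  zvalP : `[< exists x : P, zval = (0 * x)%PM >]
}.

HB.instance Definition _ P := [isSub for @zval P].
HB.instance Definition _ P := [Choice of zeros P by <:].

Section ZerosOrder.
Variable P : preMeadowType.
Implicit Types z : zeros P.
Local Open Scope pre_meadow_scope.

Definition zeros_le z z' : bool := zval z * z' == z :> P.

Lemma zeros_le_refl : reflexive zeros_le.
Proof. by move=> [z /[dup] /asboolP[x ->] ?]; rewrite /zeros_le /= pm_mul0x0x. Qed.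

Lemma zeros_le_anti : antisymmetric zeros_le.
Proof.
move=> z z' /andP[/eqP h /eqP h']; apply: val_inj => /=.
by rewrite -[LHS]h pm_mulC h'.
Qed.

Lemma zeros_le_trans : transitive zeros_le.
Proof.
move=> z z1 z2 /eqP h /eqP h'; apply/eqP.
by rewrite -h pm_mulA h'.
Qed.

End ZerosOrder.

Fact zeros_display : Order.disp_t. Proof. exact: Order.Disp tt tt. Qed.

HB.instance Definition _ (P : preMeadowType) :=
  Order.Le_isPOrder.Build zeros_display (zeros P)
    (@zeros_le_refl P) (@zeros_le_anti P) (@zeros_le_trans P).

Lemma zeros_leE (P : preMeadowType) (z z' : zeros P) :
  (z <= z')%O = (pm_mul (zval z) (zval z') == zval z).
Proof. by []. Qed.

(* P_z; the ring below may be trivial, hence comPzRingType. *)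
Record fiber (P : preMeadowType) (z : zeros P) := Fiber {
  fval :> P;
  fvalP : (0 * fval)%PM == z :> P
}.

HB.instance Definition _ P (z : zeros P) := [isSub for @fval P z].
HB.instance Definition _ P (z : zeros P) := [Choice of fiber z by <:].

Section FiberRing.
Variables (P : preMeadowType) (z : zeros P).
Implicit Types x y : fiber z.
Local Open Scope pre_meadow_scope.

Lemma mul0_zeros : 0 * zval z = z.
Proof. by case: z => w /= /asboolP[x ->]; rewrite pm_mul0K. Qed.

Lemma fiberE x : 0 * fval x = z. Proof. exact/eqP/fvalP. Qed.

Lemma zeros_mulxx : zval z * z = z.
Proof. by rewrite -mul0_zeros pm_mul0x0x. Qed.

Lemma fiber_zero_subproof : 0 * zval z == z :> P.
Proof. by rewrite mul0_zeros. Qed.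

Lemma fiber_one_subproof : 0 * (1 + zval z) == z :> P.
Proof. by rewrite pm_mul0D [0 * 1]pm_mulC pm_mul1x mul0_zeros. Qed.

Lemma fiber_add_subproof x y : 0 * (fval x + y) == z :> P.
Proof. by rewrite pm_mul0DE !fiberE zeros_mulxx. Qed.

Lemma fiber_mul_subproof x y : 0 * (fval x * y) == z :> P.
Proof. by rewrite pm_mul0M fiber_add_subproof. Qed.

Lemma fiber_opp_subproof x : 0 * (- fval x) == z :> P.
Proof. by rewrite pm_mul0N fiberE. Qed.

Definition fiber_zero := Fiber fiber_zero_subproof.
Definition fiber_one := Fiber fiber_one_subproof.
Definition fiber_add x y := Fiber (fiber_add_subproof x y).
Definition fiber_mul x y := Fiber (fiber_mul_subproof x y).
Definition fiber_opp x := Fiber (fiber_opp_subproof x).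

Lemma fiber_addA : associative fiber_add.
Proof. by move=> x y t; apply: val_inj; rewrite /= pm_addA. Qed.

Lemma fiber_addC : commutative fiber_add.
Proof. by move=> x y; apply: val_inj; rewrite /= pm_addC. Qed.

Lemma fiber_add0 : left_id fiber_zero fiber_add.
Proof.
by move=> x; apply: val_inj; rewrite /= -(fiberE x) pm_addC pm_addx0x.
Qed.

Lemma fiber_addN : left_inverse fiber_zero fiber_opp fiber_add.
Proof.
by move=> x; apply: val_inj; rewrite /= pm_addC pm_addxN fiberE.
Qed.

Lemma fiber_mulA : associative fiber_mul.
Proof. by move=> x y t; apply: val_inj; rewrite /= pm_mulA. Qed.

Lemma fiber_mulC : commutative fiber_mul.
Proof. by move=> x y; apply: val_inj; rewrite /= pm_mulC. Qed.

Lemma fiber_mul1 : left_id fiber_one fiber_mul.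
Proof.
move=> x; apply: val_inj; rewrite /= pm_mulC pm_mulDr pm_mulC pm_mul1x.
by rewrite -(fiberE x) [_ * (0 * _)]pm_mulC pm_mul0xx pm_addx0x.
Qed.

Lemma fiber_mulD : left_distributive fiber_mul fiber_add.
Proof.
by move=> x y t; apply: val_inj; rewrite /= pm_mulC pm_mulDr ![_ * fval t]pm_mulC.
Qed.

HB.instance Definition _ := GRing.isZmodule.Build (fiber z)
  fiber_addA fiber_addC fiber_add0 fiber_addN.
HB.instance Definition _ := GRing.Zmodule_isComPzRing.Build (fiber z)
  fiber_mulA fiber_mulC fiber_mul1 fiber_mulD.

End FiberRing.

Definition pre_meadow_with_a (P : preMeadowType) : Prop :=
  exists! a : zeros P,
    (exists! x : P, (0 * x)%PM = a) /\ (forall x : P, (x + a)%PM = a).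

Record opens (X : topologicalType) := Opens {
  oval :> set X;
  ovalP : `[< open oval >]
}.

HB.instance Definition _ X := [isSub for @oval X].
HB.instance Definition _ X := [Choice of opens X by <:].

Fact opens_display : Order.disp_t. Proof. exact: Order.Disp tt tt. Qed.

HB.instance Definition _ X :=
  [SubChoice_isSubPOrder of opens X by <: with opens_display].

Lemma opens_leE (X : topologicalType) (U V : opens X) :
  (U <= V)%O = (U `<=` V) :> Prop.
Proof. exact: subsetEset. Qed.

Lemma opens_empty_subproof (X : topologicalType) : `[< open (@set0 X) >].
Proof. exact/asboolP/open0. Qed.

Definition opens_empty (X : topologicalType) : opens X :=
  Opens (opens_empty_subproof X).

(* Binary meets and joins are the members of infimums [set x; y] and
   supremums [set x; y]; each set has at most one element. *)
Definition is_lattice d (L : porderType d) : Prop := forall x y : L,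
  infimums [set x; y] !=set0 /\ supremums [set x; y] !=set0.

Record lattice_iso d d' (L : porderType d) (M : porderType d') := LatticeIso {
  iso_fun :> L -> M;
  iso_inv : M -> L;
  iso_funK : cancel iso_fun iso_inv;
  iso_invK : cancel iso_inv iso_fun;
  iso_meet : forall x y m : L, infimums [set x; y] m ->
    infimums [set iso_fun x; iso_fun y] (iso_fun m);
  iso_join : forall x y j : L, supremums [set x; y] j ->
    supremums [set iso_fun x; iso_fun y] (iso_fun j)
}.

(* The structure of a presheaf of commutative rings whose rings of sections
   are the given F U. *)
Record presheaf_on (X : topologicalType) (F : opens X -> comPzRingType) :=
  PresheafOn {
  restr : forall U V : opens X, V `<=` U -> {rmorphism F U -> F V};
  restr_id : forall (U : opens X) (UU : U `<=` U) (s : F U), restr UU s = s;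
  restr_comp : forall (U V W : opens X)
    (VU : V `<=` U) (WV : W `<=` V) (WU : W `<=` U) (s : F U),
    restr WV (restr VU s) = restr WU s;
  sections_empty : forall s : F (opens_empty X), s = 0%R
}.

(* Main.v *)
(* The isomorphism carries the order of opens back to the zeros, so that the
   transition maps are defined, and each is a ring morphism because a zero
   element v is additively idempotent and absorbs, through x v = (0 x) v, every
   x whose zero lies above it.  The element a lies below every zero, since
   z + a = z a on zeros; hence it corresponds to the empty set, whose ring
   of sections is then the singleton P_a. *)
Require Import Defs.
From HB Require Import structures.
From mathcomp Require Import all_boot all_order all_algebra.
From mathcomp Require Import boolp classical_sets topology.

Set Implicit Arguments.
Unset Strict Implicit.
Unset Printing Implicit Defensive.

Import Order.TTheory GRing.Theory.

Local Open Scope classical_set_scope.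

Section Zeros.
Variable P : preMeadowType.
Implicit Types (x : P) (v z : zeros P).
Local Open Scope pre_meadow_scope.

Lemma zeros_addxx z : zval z + z = z.
Proof. by rewrite -(mul0_zeros z) pm_mul0_idem. Qed.

(** Multiplication by [0] fixes every zero, so [z + v = 0 * (z + v) = (0 * z) * (0 * v) = z * v]. *)
Lemma zeros_addE z v : zval z + v = zval z * v.
Proof.
rewrite -{1}(mul0_zeros z) -{1}(mul0_zeros v) -pm_mulDr pm_mul0DE.
by rewrite !mul0_zeros.
Qed.

Lemma mul_zerosE x v : x * zval v = (0 * x) * zval v.
Proof. by rewrite -{1}(mul0_zeros v) -pm_mulA [x * 0]pm_mulC. Qed.

Lemma zeros_le_addE z v : (v <= z)%O -> zval z + v = v.
Proof. by rewrite zeros_leE zeros_addE pm_mulC => /eqP. Qed.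

End Zeros.

Section Transition.
Variables (P : preMeadowType) (u v : zeros P) (vu : (v <= u)%O).

Lemma transition_subproof (x : fiber u) : (0 * (fval x + zval v))%PM == v :> P.
Proof. by rewrite pm_mul0DE fiberE mul0_zeros -zeros_addE zeros_le_addE. Qed.

Definition transition (x : fiber u) : fiber v := Fiber (transition_subproof x).

Lemma fiber_mul_zeros (x : fiber u) : (fval x * zval v)%PM = v.
Proof. by rewrite mul_zerosE fiberE -zeros_addE zeros_le_addE. Qed.

Lemma transitionD : {morph transition : x y / (x + y)%R}.
Proof.
move=> x y; apply: val_inj => /=.
(* Doubling [v] gives each summand its own copy. *)
by rewrite pm_addA -[in LHS](zeros_addxx v) -!pm_addA
  [(fval x + _ + _)%PM]pm_addA [(fval y + _)%PM]pm_addC -!pm_addA.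
Qed.

Lemma transition_zmod_morphism : zmod_morphism transition.
Proof. by move=> x y; apply: (canRL (addrK _)); rewrite -transitionD subrK. Qed.

Lemma transition_monoid_morphism : monoid_morphism transition.
Proof.
split=> [|x y]; apply: val_inj => /=; first by rewrite pm_addA zeros_le_addE.
(* In the expansion of [(x + v) * (y + v)], every term except [x * y] equals [v], and these terms
   add up to [v]. *)
rewrite pm_mulDr [((_ + _) * fval y)%PM]pm_mulC pm_mulDr.
rewrite [((_ + _) * zval v)%PM]pm_mulC pm_mulDr zeros_mulxx.
rewrite [(zval v * _)%PM]pm_mulC !fiber_mul_zeros zeros_addxx.
by rewrite pm_addA zeros_addxx [(fval y * _)%PM]pm_mulC.
Qed.

HB.instance Definition _ := GRing.isZmodMorphism.Build (fiber u) (fiber v)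
  transition transition_zmod_morphism.
HB.instance Definition _ := GRing.isMonoidMorphism.Build (fiber u) (fiber v)
  transition transition_monoid_morphism.

Definition transition_rmorphism : {rmorphism fiber u -> fiber v} := transition.

End Transition.

Section IsoOrder.
Context {d d'} {L : porderType d} {M : porderType d'}.
Variables (hL : is_lattice L) (Phi : lattice_iso L M).

(** [lattice_iso] speaks of meets, not of the order. The order is recovered from them: the meet of
    the two preimages is sent to the meet of [V] and [U], which is [V]. *)
Lemma lattice_iso_inv_le (V U : M) :
  (V <= U)%O -> (iso_inv Phi V <= iso_inv Phi U)%O.
Proof.
move=> VU; have [[m mP] _] := hL (iso_inv Phi V) (iso_inv Phi U).
have [m_lb _] := mP; have := iso_meet Phi mP.
rewrite !iso_invK => -[lbPm ubPm].
have PmE : Phi m = V.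
  apply/le_anti/andP; split; first by apply: lbPm; left.
  by apply: ubPm => _ [->|->].
by rewrite -{1}PmE iso_funK; apply: m_lb; right.
Qed.

End IsoOrder.

Theorem lemma3p12 (X : topologicalType) (P : preMeadowType)
    (hP : pre_meadow_with_a P) (hL : is_lattice (zeros P))
    (Phi : lattice_iso (zeros P) (opens X)) :
  exists F : presheaf_on (fun U : opens X => fiber (iso_inv Phi U)),
    forall (U V : opens X) (VU : V `<=` U) (x : fiber (iso_inv Phi U)),
      fval (restr F VU x) = (fval x + zval (iso_inv Phi V))%PM.
Proof.
have le_inv (U V : opens X) : V `<=` U -> (iso_inv Phi V <= iso_inv Phi U)%O.
  by rewrite -opens_leE; apply: lattice_iso_inv_le.
pose r (U V : opens X) (VU : V `<=` U) := transition_rmorphism (le_inv U V VU).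
have r_id (U : opens X) (UU : U `<=` U) s : r U U UU s = s.
  by apply: val_inj; rewrite /= -(fiberE s) pm_addx0x.
have r_comp (U V W : opens X) (VU : V `<=` U) (WV : W `<=` V) (WU : W `<=` U) s :
    r V W WV (r U V VU s) = r U W WU s.
  by apply: val_inj; rewrite /= pm_addA (zeros_le_addE (le_inv _ _ WV)).
have r_empty (s : fiber (iso_inv Phi (opens_empty X))) : s = 0%R.
  have [a [[[b [_ b_uniq]] addxa] _]] := hP.
  have aE : iso_inv Phi (opens_empty X) = a.
    (* One inequality comes from the inclusion of the empty set in [Phi a], the other from the
       absorption law of [a]. *)
    apply: le_anti; rewrite -{1}(iso_funK Phi a) le_inv ?zeros_leE /=.
      by rewrite pm_mulC -zeros_addE addxa.
    exact: sub0set.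
  (* The section [s] and the zero of the ring both lie over [a], hence both equal [b]. *)
  apply: val_inj; rewrite /= -(b_uniq (fval s)) ?fiberE ?aE //.
  by apply: b_uniq; rewrite mul0_zeros.
by exists (PresheafOn r_id r_comp r_empty).
Qed.
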